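(* Let $s=3$ and let $$\beta^{(1)T}=\begin{bmatrix}\tfrac14&\tfrac38&\tfrac38\end{bmatrix},\quad \beta^{(2)T}=\begin{bmatrix}0&\tfrac{\sqrt6}4&-\tfrac{\sqrt6}4\end{bmatrix},\quad \beta^{(3)T}=\begin{bmatrix}-\tfrac14&\tfrac18&\tfrac18\end{bmatrix},\quad \beta^{(4)T}=\begin{bmatrix}0&\tfrac{\sqrt2}4&-\tfrac{\sqrt2}4\end{bmatrix},$$ $$A^{(1)}=\begin{bmatrix}0&0&0\\\tfrac23&0&0\\\tfrac23&0&0\end{bmatrix},\quad B^{(1)}=\begin{bmatrix}0&0&0\\\sqrt{\tfrac23}&0&0\\-\sqrt{\tfrac23}&0&0\end{bmatrix},\quad A^{(2)}=0,\quad B^{(2)}=\begin{bmatrix}0&0&0\\\sqrt2&0&0\\-\sqrt2&0&0\end{bmatrix}.$$ Combine these with one of the following choices of $\alpha,A^{(0)},B^{(0)}$: RDI2WM: $\alpha^T=\begin{bmatrix}\frac12&\frac12&0\end{bmatrix}$, $A^{(0)}=\begin{bmatrix}0&0&0\\1&0&0\\0&0&0\end{bmatrix}$, $B^{(0)}=\begin{bmatrix}0&0&0\\1&0&0\\0&0&0\end{bmatrix}$; RDI3WM: $\alpha^T=\begin{bmatrix}\frac29&\frac13&\frac49\end{bmatrix}$, $A^{(0)}=\begin{bmatrix}0&0&0\\\frac12&0&0\\0&\frac34&0\end{bmatrix}$, $B^{(0)}=\begin{bmatrix}0&0&0\\\frac{9-2\sqrt{15}}{14}&0&0\\\frac{18+3\sqrt{15}}{28}&0&0\end{bmatrix}$;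 RDI4WM: $\alpha^T=\begin{bmatrix}\frac16&\frac23&\frac16\end{bmatrix}$, $A^{(0)}=\begin{bmatrix}0&0&0\\\frac12&0&0\\-1&2&0\end{bmatrix}$, $B^{(0)}=\begin{bmatrix}0&0&0\\\frac{6-\sqrt6}{10}&0&0\\\frac{3+2\sqrt6}{5}&0&0\end{bmatrix}$. Then each of the three schemes satisfies all of the conditions 1.--50. (so it is of order $p_D=p_S=2$) and in addition the order three conditions $$\beta^{(2)T}((A^{(1)}e)(B^{(1)}e))\,(\beta^{(1)T}e)^2=\tfrac23,\qquad (\beta^{(1)T}e)(\beta^{(3)T}(B^{(2)}e)^4)=1 .$$ RDI3WM and RDI4WM moreover satisfy the deterministic order three conditions $\alpha^T(A^{(0)}e)^2=\frac13$ and $\alpha^T(A^{(0)}(A^{(0)}e))=\frac16$ (so they are of order $p_D=3$, $p_S=2$). In addition, RDI3WM satisfies the deterministic order four conditions $$\alpha^T(A^{(0)}(A^{(0)}e)^2)=\tfrac1{12},\qquad \alpha^T((A^{(0)}e)(A^{(0)}(A^{(0)}e)))=\tfrac18,$$ and RDI4WM satisfies the deterministic order four conditions $$\alpha^T(A^{(0)}(A^{(0)}e)^2)=\tfrac1{12},\qquad \alpha^T(A^{(0)}e)^3=\tfrac14 .$$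
   Context: An explicit $s$-stage stochastic Runge--Kutta (SRK) method of the class considered is determined by vectors $\alpha,\beta^{(1)},\beta^{(2)},\beta^{(3)},\beta^{(4)}\in\mathbb{R}^s$ and matrices $A^{(q)},B^{(q)}\in\mathbb{R}^{s\times s}$, $q=0,1,2$, with $A^{(q)}_{ij}=B^{(q)}_{ij}=0$ for $j\ge i$. Let $e=(1,\dots,1)^T\in\mathbb{R}^s$. Products and powers of column vectors are component-wise. $p_D$ denotes the deterministic and $p_S$ the weak stochastic order; order $(p_D,p_S)=(2,2)$ is understood through conditions 1.--50., and $(3,2)$ through these together with the two deterministic order three conditions stated in the claim. The order conditions are: 1. $\alpha^Te=1$; 2. $\beta^{(4)T}e=0$; 3. $\beta^{(3)T}e=0$; 4. $(\beta^{(1)T}e)^2=1$; 5. $\beta^{(2)T}e=0$; 6. $\beta^{(1)T}B^{(1)}e=0$; 7. $\beta^{(3)T}B^{(2)}e=0$; 8. $\alpha^TA^{(0)}e=\tfrac12$; 9. $\alpha^T(B^{(0)}e)^2=\tfrac12$; 10. $(\beta^{(1)T}e)(\alpha^TB^{(0)}e)=\tfrac12$; 11. $(\beta^{(1)T}e)(\beta^{(1)T}A^{(1)}e)=\tfrac12$; 12. $\beta^{(3)T}A^{(2)}e=0$; 13. $\beta^{(2)T}B^{(1)}e=1$; 14. $\beta^{(4)T}B^{(2)}e=1$; 15. $(\beta^{(1)T}e)(\beta^{(1)T}(B^{(1)}e)^2)=\tfrac12$; 16. $(\beta^{(1)T}e)(\beta^{(3)T}(B^{(2)}e)^2)=\tfrac12$;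 17. $\beta^{(1)T}(B^{(1)}(B^{(1)}e))=0$; 18. $\beta^{(3)T}(B^{(2)}(B^{(1)}e))=0$; 19. $\beta^{(3)T}(A^{(2)}(B^{(0)}e))=0$; 20. $\beta^{(1)T}(A^{(1)}(B^{(0)}e))=0$; 21. $\alpha^T(B^{(0)}(B^{(1)}e))=0$; 22. $\beta^{(2)T}A^{(1)}e=0$; 23. $\beta^{(4)T}A^{(2)}e=0$; 24. $\beta^{(1)T}((A^{(1)}e)(B^{(1)}e))=0$; 25. $\beta^{(3)T}((A^{(2)}e)(B^{(2)}e))=0$; 26. $\beta^{(4)T}(A^{(2)}(B^{(0)}e))=0$; 27. $\beta^{(2)T}(A^{(1)}(B^{(0)}e))=0$; 28. $\beta^{(2)T}(A^{(1)}(B^{(0)}e)^2)=0$; 29. $\beta^{(4)T}(A^{(2)}(B^{(0)}e)^2)=0$; 30. $\beta^{(3)T}(B^{(2)}(A^{(1)}e))=0$; 31. $\beta^{(1)T}(B^{(1)}(A^{(1)}e))=0$; 32. $\beta^{(2)T}(B^{(1)}e)^2=0$; 33. $\beta^{(4)T}(B^{(2)}e)^2=0$; 34. $\beta^{(4)T}(B^{(2)}(B^{(1)}e))=0$; 35. $\beta^{(2)T}(B^{(1)}(B^{(1)}e))=0$; 36. $\beta^{(1)T}(B^{(1)}e)^3=0$; 37. $\beta^{(3)T}(B^{(2)}e)^3=0$; 38. $\beta^{(1)T}(B^{(1)}(B^{(1)}e)^2)=0$; 39. $\beta^{(3)T}(B^{(2)}(B^{(1)}e)^2)=0$; 40. $\alpha^T((B^{(0)}e)(B^{(0)}(B^{(1)}e)))=0$;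 41. $\beta^{(1)T}((A^{(1)}(B^{(0)}e))(B^{(1)}e))=0$; 42. $\beta^{(3)T}((A^{(2)}(B^{(0)}e))(B^{(2)}e))=0$; 43. $\beta^{(1)T}(A^{(1)}(B^{(0)}(B^{(1)}e)))=0$; 44. $\beta^{(3)T}(A^{(2)}(B^{(0)}(B^{(1)}e)))=0$; 45. $\beta^{(1)T}(B^{(1)}(A^{(1)}(B^{(0)}e)))=0$; 46. $\beta^{(3)T}(B^{(2)}(A^{(1)}(B^{(0)}e)))=0$; 47. $\beta^{(1)T}((B^{(1)}e)(B^{(1)}(B^{(1)}e)))=0$; 48. $\beta^{(3)T}((B^{(2)}e)(B^{(2)}(B^{(1)}e)))=0$; 49. $\beta^{(1)T}(B^{(1)}(B^{(1)}(B^{(1)}e)))=0$; 50. $\beta^{(3)T}(B^{(2)}(B^{(1)}(B^{(1)}e)))=0$. *)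

(* Defs.v *)
From HB Require Import structures.
From mathcomp Require Import all_boot all_order all_algebra.
From mathcomp Require Import reals.

Set Implicit Arguments.
Unset Strict Implicit.
Unset Printing Implicit Defensive.

Import Order.TTheory GRing.Theory Num.Theory.
Local Open Scope ring_scope.

Definition strict_lower (R : pzRingType) s (A : 'M[R]_s) : Prop :=
  forall i j : 'I_s, (i <= j)%N -> A i j = 0.

(* A method is its table of coefficients; explicitness is part of the type. *)
Record explicitSRK (R : pzRingType) (s : nat) := ExplicitSRK {
  alpha : 'cV[R]_s;
  beta1 : 'cV[R]_s;
  beta2 : 'cV[R]_s;
  beta3 : 'cV[R]_s;
  beta4 : 'cV[R]_s;
  A0 : 'M[R]_s;
  A1 : 'M[R]_s;
  A2 : 'M[R]_s;
  B0 : 'M[R]_s;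
  B1 : 'M[R]_s;
  B2 : 'M[R]_s;
  A0_lower : strict_lower A0;
  A1_lower : strict_lower A1;
  A2_lower : strict_lower A2;
  B0_lower : strict_lower B0;
  B1_lower : strict_lower B1;
  B2_lower : strict_lower B2
}.

Definition ones {R : pzRingType} {s : nat} : 'cV[R]_s := const_mx 1.

(* u^T v as a scalar: the only entry of the 1 x 1 matrix u^T *m v. *)
Definition dot (R : pzRingType) s (u v : 'cV[R]_s) : R := (u^T *m v) 0 0.

Definition cwmul (R : pzRingType) s (u v : 'cV[R]_s) : 'cV[R]_s :=
  map2_mx *%R u v.

Definition cwexp (R : pzRingType) s (u : 'cV[R]_s) (n : nat) : 'cV[R]_s :=
  map_mx (fun x => x ^+ n) u.

Notation "u .* v" := (cwmul u v) (at level 40, left associativity) : ring_scope.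
Notation "u .^ n" := (cwexp u n) (at level 29, left associativity) : ring_scope.

Local Notation e := ones.

(* order (p_D, p_S) = (2, 2) *)
Record order22 (R : realType) (s : nat) (M : explicitSRK R s) : Prop := Order22 {
  cond1  : dot (alpha M) e = 1;
  cond2  : dot (beta4 M) e = 0;
  cond3  : dot (beta3 M) e = 0;
  cond4  : (dot (beta1 M) e) ^+ 2 = 1;
  cond5  : dot (beta2 M) e = 0;
  cond6  : dot (beta1 M) (B1 M *m e) = 0;
  cond7  : dot (beta3 M) (B2 M *m e) = 0;
  cond8  : dot (alpha M) (A0 M *m e) = 1 / 2;
  cond9  : dot (alpha M) ((B0 M *m e) .^ 2) = 1 / 2;
  cond10 : dot (beta1 M) e * dot (alpha M) (B0 M *m e) = 1 / 2;
  cond11 : dot (beta1 M) e * dot (beta1 M) (A1 M *m e) = 1 / 2;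
  cond12 : dot (beta3 M) (A2 M *m e) = 0;
  cond13 : dot (beta2 M) (B1 M *m e) = 1;
  cond14 : dot (beta4 M) (B2 M *m e) = 1;
  cond15 : dot (beta1 M) e * dot (beta1 M) ((B1 M *m e) .^ 2) = 1 / 2;
  cond16 : dot (beta1 M) e * dot (beta3 M) ((B2 M *m e) .^ 2) = 1 / 2;
  cond17 : dot (beta1 M) (B1 M *m (B1 M *m e)) = 0;
  cond18 : dot (beta3 M) (B2 M *m (B1 M *m e)) = 0;
  cond19 : dot (beta3 M) (A2 M *m (B0 M *m e)) = 0;
  cond20 : dot (beta1 M) (A1 M *m (B0 M *m e)) = 0;
  cond21 : dot (alpha M) (B0 M *m (B1 M *m e)) = 0;
  cond22 : dot (beta2 M) (A1 M *m e) = 0;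
  cond23 : dot (beta4 M) (A2 M *m e) = 0;
  cond24 : dot (beta1 M) ((A1 M *m e) .* (B1 M *m e)) = 0;
  cond25 : dot (beta3 M) ((A2 M *m e) .* (B2 M *m e)) = 0;
  cond26 : dot (beta4 M) (A2 M *m (B0 M *m e)) = 0;
  cond27 : dot (beta2 M) (A1 M *m (B0 M *m e)) = 0;
  cond28 : dot (beta2 M) (A1 M *m ((B0 M *m e) .^ 2)) = 0;
  cond29 : dot (beta4 M) (A2 M *m ((B0 M *m e) .^ 2)) = 0;
  cond30 : dot (beta3 M) (B2 M *m (A1 M *m e)) = 0;
  cond31 : dot (beta1 M) (B1 M *m (A1 M *m e)) = 0;
  cond32 : dot (beta2 M) ((B1 M *m e) .^ 2) = 0;
  cond33 : dot (beta4 M) ((B2 M *m e) .^ 2) = 0;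
  cond34 : dot (beta4 M) (B2 M *m (B1 M *m e)) = 0;
  cond35 : dot (beta2 M) (B1 M *m (B1 M *m e)) = 0;
  cond36 : dot (beta1 M) ((B1 M *m e) .^ 3) = 0;
  cond37 : dot (beta3 M) ((B2 M *m e) .^ 3) = 0;
  cond38 : dot (beta1 M) (B1 M *m ((B1 M *m e) .^ 2)) = 0;
  cond39 : dot (beta3 M) (B2 M *m ((B1 M *m e) .^ 2)) = 0;
  cond40 : dot (alpha M) ((B0 M *m e) .* (B0 M *m (B1 M *m e))) = 0;
  cond41 : dot (beta1 M) ((A1 M *m (B0 M *m e)) .* (B1 M *m e)) = 0;
  cond42 : dot (beta3 M) ((A2 M *m (B0 M *m e)) .* (B2 M *m e)) = 0;
  cond43 : dot (beta1 M) (A1 M *m (B0 M *m (B1 M *m e))) = 0;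
  cond44 : dot (beta3 M) (A2 M *m (B0 M *m (B1 M *m e))) = 0;
  cond45 : dot (beta1 M) (B1 M *m (A1 M *m (B0 M *m e))) = 0;
  cond46 : dot (beta3 M) (B2 M *m (A1 M *m (B0 M *m e))) = 0;
  cond47 : dot (beta1 M) ((B1 M *m e) .* (B1 M *m (B1 M *m e))) = 0;
  cond48 : dot (beta3 M) ((B2 M *m e) .* (B2 M *m (B1 M *m e))) = 0;
  cond49 : dot (beta1 M) (B1 M *m (B1 M *m (B1 M *m e))) = 0;
  cond50 : dot (beta3 M) (B2 M *m (B1 M *m (B1 M *m e))) = 0
}.

(* order (p_D, p_S) = (3, 2) *)
Definition order32 (R : realType) (s : nat) (M : explicitSRK R s) : Prop :=
  [/\ order22 M,
      dot (alpha M) ((A0 M *m e) .^ 2) = 1 / 3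
    & dot (alpha M) (A0 M *m (A0 M *m e)) = 1 / 6].

Definition colseq (R : pzRingType) s (l : seq R) : 'cV[R]_s :=
  \col_(i < s) l`_i.

Definition mxseq (R : pzRingType) s (rows : seq (seq R)) : 'M[R]_s :=
  \matrix_(i < s, j < s) (nth [::] rows i)`_j.

Lemma mxseq3_lower (R : pzRingType) (a b c : R) :
  strict_lower (mxseq 3 [:: [:: 0; 0; 0]; [:: a; 0; 0]; [:: b; c; 0]]).
Proof. by move=> [[|[|[|i]]] hi] [[|[|[|j]]] hj] //= _; rewrite mxE. Qed.

Lemma mx0_lower (R : pzRingType) s : strict_lower (0 : 'M[R]_s).
Proof. by move=> i j _; rewrite mxE. Qed.

(* The coefficients shared by the three schemes, completed by given
   alpha, A0 and B0. *)
Definition RDIWM (R : realType) (al : 'cV[R]_3) (a0 b0 : 'M[R]_3)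
    (a0_lower : strict_lower a0) (b0_lower : strict_lower b0) :
    explicitSRK R 3 :=
  {| alpha := al;
     beta1 := colseq 3 [:: 1 / 4; 3 / 8; 3 / 8];
     beta2 := colseq 3 [:: 0; Num.sqrt 6 / 4; - (Num.sqrt 6 / 4)];
     beta3 := colseq 3 [:: - (1 / 4); 1 / 8; 1 / 8];
     beta4 := colseq 3 [:: 0; Num.sqrt 2 / 4; - (Num.sqrt 2 / 4)];
     A0 := a0;
     A1 := mxseq 3 [:: [:: 0;     0; 0];
                       [:: 2 / 3; 0; 0];
                       [:: 2 / 3; 0; 0]];
     A2 := 0;
     B0 := b0;
     B1 := mxseq 3 [:: [:: 0;                    0; 0];
                       [:: Num.sqrt (2 / 3);     0; 0];
                       [:: - Num.sqrt (2 / 3);   0; 0]];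
     B2 := mxseq 3 [:: [:: 0;              0; 0];
                       [:: Num.sqrt 2;     0; 0];
                       [:: - Num.sqrt 2;   0; 0]];
     A0_lower := a0_lower;
     A1_lower := mxseq3_lower _ _ _;
     A2_lower := @mx0_lower _ _;
     B0_lower := b0_lower;
     B1_lower := mxseq3_lower _ _ _;
     B2_lower := mxseq3_lower _ _ _ |}.

Definition RDI2WM (R : realType) : explicitSRK R 3 :=
  @RDIWM R
    (colseq 3 [:: 1 / 2; 1 / 2; 0])
    (mxseq 3 [:: [:: 0; 0; 0];
                 [:: 1; 0; 0];
                 [:: 0; 0; 0]])
    (mxseq 3 [:: [:: 0; 0; 0];
                 [:: 1; 0; 0];
                 [:: 0; 0; 0]])
    (mxseq3_lower _ _ _) (mxseq3_lower _ _ _).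

Definition RDI3WM (R : realType) : explicitSRK R 3 :=
  @RDIWM R
    (colseq 3 [:: 2 / 9; 1 / 3; 4 / 9])
    (mxseq 3 [:: [:: 0;     0;     0];
                 [:: 1 / 2; 0;     0];
                 [:: 0;     3 / 4; 0]])
    (mxseq 3 [:: [:: 0;                                0; 0];
                 [:: (9 - 2 * Num.sqrt 15) / 14;       0; 0];
                 [:: (18 + 3 * Num.sqrt 15) / 28;      0; 0]])
    (mxseq3_lower _ _ _) (mxseq3_lower _ _ _).

Definition RDI4WM (R : realType) : explicitSRK R 3 :=
  @RDIWM R
    (colseq 3 [:: 1 / 6; 2 / 3; 1 / 6])
    (mxseq 3 [:: [:: 0;     0; 0];
                 [:: 1 / 2; 0; 0];
                 [:: -1;    2; 0]])
    (mxseq 3 [:: [:: 0;                            0; 0];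
                 [:: (6 - Num.sqrt 6) / 10;        0; 0];
                 [:: (3 + 2 * Num.sqrt 6) / 5;     0; 0]])
    (mxseq3_lower _ _ _) (mxseq3_lower _ _ _).

Definition stochastic_order3_conds (R : realType) (s : nat)
    (M : explicitSRK R s) : Prop :=
  dot (beta2 M) ((A1 M *m e) .* (B1 M *m e)) * (dot (beta1 M) e) ^+ 2 = 2 / 3
  /\ dot (beta1 M) e * dot (beta3 M) ((B2 M *m e) .^ 4) = 1.

(* Main.v *)
Require Import Defs.
From HB Require Import structures.
From mathcomp Require Import all_boot all_order all_algebra.
From mathcomp Require Import reals.
From mathcomp Require Import ring.

Import Order.TTheory GRing.Theory Num.Theory.
Local Open Scope ring_scope.

(** [A1], [B0], [B1], [B2] have only their first column nonzero, with first entry zero, and [A2] is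
    zero. Hence [A1 e], [B0 e], [B1 e], [B2 e] vanish in the first stage and any nested product
    built from these matrices is zero. In stages two and three [B1 e] and [B2 e] take opposite
    values, where [beta1] and [beta3] are even and [beta2] and [beta4] odd, so sums of the wrong
    parity cancel. What survives is a few scalar identities, uniform in alpha, [A0], [B0]
    ([RDIWM_order22], [RDIWM_order32]) and checked using the squares of the radicals. *)

Section ThreeStageVectors.
Context {R : comPzRingType}.
Implicit Types a b c d f g h k l x y z : R.

Lemma ones3E : ones = colseq 3 [:: 1; 1; 1] :> 'cV[R]_3.
Proof. by apply/matrixP => -[[|[|[|i]]] hi] j //; rewrite !mxE. Qed.

(** Puts [A2] in tabular form, so that [mulmx3E] also evaluates products with it. *)
Lemma mx0_3E :
  0 = mxseq 3 [:: [:: 0; 0; 0]; [:: 0; 0; 0]; [:: 0; 0; 0]] :> 'M[R]_3.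
Proof.
by apply/matrixP => -[[|[|[|i]]] hi] [[|[|[|j]]] hj] //; rewrite !mxE.
Qed.

Lemma dot3E a b c x y z :
  dot (colseq 3 [:: a; b; c]) (colseq 3 [:: x; y; z]) =
  a * x + b * y + c * z.
Proof. by rewrite /dot !mxE !big_ord_recr big_ord0 /= !mxE /= add0r. Qed.

Lemma cwmul3E a b c x y z :
  colseq 3 [:: a; b; c] .* colseq 3 [:: x; y; z] =
  colseq 3 [:: a * x; b * y; c * z].
Proof. by apply/matrixP => -[[|[|[|i]]] hi] j //; rewrite !mxE. Qed.

Lemma cwexp3E a b c n :
  colseq 3 [:: a; b; c] .^ n = colseq 3 [:: a ^+ n; b ^+ n; c ^+ n].
Proof. by apply/matrixP => -[[|[|[|i]]] hi] j //; rewrite !mxE. Qed.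

Lemma mulmx3E a b c d f g h k l x y z :
  mxseq 3 [:: [:: a; b; c]; [:: d; f; g]; [:: h; k; l]]
    *m colseq 3 [:: x; y; z] =
  colseq 3 [:: a * x + b * y + c * z; d * x + f * y + g * z;
               h * x + k * y + l * z].
Proof.
by apply/matrixP => -[[|[|[|i]]] hi] j //;
  rewrite !mxE !big_ord_recr big_ord0 /= !mxE /= add0r.
Qed.

Definition colseq3E :=
  (ones3E, mx0_3E, mulmx3E, cwexp3E, cwmul3E, dot3E).

End ThreeStageVectors.

Lemma sqrt_sqr_nat (R : realType) (n : nat) :
  Num.sqrt n%:R ^+ 2 = n%:R :> R.
Proof. by rewrite sqr_sqrtr ?ler0n. Qed.

(** Leaves [Num.sqrt 6] as the only radical in [beta2] and [B1], so that one relation settles their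
    products. *)
Lemma sqrt_two_thirds (R : realType) :
  Num.sqrt (2 / 3) = Num.sqrt 6 / 3 :> R.
Proof.
have -> : 2 / 3 = 6 * (3^-1) ^+ 2 :> R by field.
by rewrite sqrtrM ?ler0n// sqrtr_sqr ger0_norm ?invr_ge0 ?ler0n.
Qed.

Section CommonCoefficients.
Context {R : realType}.
Variables (x y z a b c p q : R).
Let al := colseq 3 [:: x; y; z].
Let a0 := mxseq 3 [:: [:: 0; 0; 0]; [:: a; 0; 0]; [:: b; c; 0]].
Let b0 := mxseq 3 [:: [:: 0; 0; 0]; [:: p; 0; 0]; [:: q; 0; 0]].
Variables (a0_lower : strict_lower a0) (b0_lower : strict_lower b0).
Let M : explicitSRK R 3 := RDIWM al a0_lower b0_lower.

(* Since the first entry of [B1 *m e] vanishes, [B0 *m (B1 *m e) = 0], so only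
   conditions 1, 8, 9 and 10 constrain alpha, A0 and B0. *)
Lemma RDIWM_order22 :
  x + y + z = 1 -> y * a + z * (b + c) = 1 / 2 ->
  y * p ^+ 2 + z * q ^+ 2 = 1 / 2 -> y * p + z * q = 1 / 2 ->
  order22 M.
Proof.
move=> h1 h8 h9 h10.
have h2 := @sqrt_sqr_nat R 2; have h6 := @sqrt_sqr_nat R 6.
split; rewrite /M /al /a0 /b0 /= ?sqrt_two_thirds !colseq3E.
all: try by ring.
all: try by field.
(* Left over are [cond1], [cond8], [cond9], [cond10], which are the hypotheses, and [cond13] to
   [cond16], where a squared radical survives. *)
- by rewrite !mulr1.
- by rewrite -h8; ring.
- by rewrite -h9; ring.
- by rewrite -h10; field.
- by field: h6.
- by field: h2.
- by field: h6.
- by field: h2.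
Qed.

Lemma RDIWM_stochastic_order3 : stochastic_order3_conds M.
Proof.
have h2 := @sqrt_sqr_nat R 2; have h6 := @sqrt_sqr_nat R 6.
split; rewrite /M /al /a0 /b0 /= ?sqrt_two_thirds !colseq3E.
  by field: h6.
by field: h2.
Qed.

(** Here [A0 e] is [(0, a, b + c)] and [A0 (A0 e)] is [(0, 0, c * a)]. *)
Lemma RDIWM_order32 :
  order22 M ->
  y * a ^+ 2 + z * (b + c) ^+ 2 = 1 / 3 -> z * c * a = 1 / 6 ->
  order32 M.
Proof.
move=> o22 h3 h4; split=> //; rewrite /M /al /a0 /b0 /= !colseq3E.
  by rewrite -h3; ring.
by rewrite -h4; ring.
Qed.

End CommonCoefficients.

Lemma RDI2WM_order22 (R : realType) : order22 (RDI2WM R).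
Proof. by apply: RDIWM_order22; field. Qed.

(** The entries [p], [q] of [B0] solve [y * p + z * q = y * p ^+ 2 + z * q ^+ 2 = 1 / 2];
    eliminating [p] gives [112 q^2 - 144 q + 27 = 0], whence the root of 15. *)
Lemma RDI3WM_order22 (R : realType) : order22 (RDI3WM R).
Proof.
have h15 := @sqrt_sqr_nat R 15.
by apply: RDIWM_order22; field: h15.
Qed.

(** The same elimination, now of [q], gives [10 p^2 - 12 p + 3 = 0], whence the root of 6. *)
Lemma RDI4WM_order22 (R : realType) : order22 (RDI4WM R).
Proof.
have h6 := @sqrt_sqr_nat R 6.
by apply: RDIWM_order22; field: h6.
Qed.

Theorem mainTheorem6 (R : realType) :
  [/\ (order22 (RDI2WM R) /\ stochastic_order3_conds (RDI2WM R)),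
      (order22 (RDI3WM R) /\ stochastic_order3_conds (RDI3WM R)),
      (order22 (RDI4WM R) /\ stochastic_order3_conds (RDI4WM R)),
      (order32 (RDI3WM R) /\ order32 (RDI4WM R))
    & (let M := RDI3WM R in
         dot (alpha M) (A0 M *m ((A0 M *m ones) .^ 2)) = 1 / 12
         /\ dot (alpha M) ((A0 M *m ones) .* (A0 M *m (A0 M *m ones))) = 1 / 8)
      /\
      (let M := RDI4WM R in
         dot (alpha M) (A0 M *m ((A0 M *m ones) .^ 2)) = 1 / 12
         /\ dot (alpha M) ((A0 M *m ones) .^ 3) = 1 / 4)].
Proof.
have o3 := RDI3WM_order22 R; have o4 := RDI4WM_order22 R.
split.
- by split; [exact: RDI2WM_order22 | exact: RDIWM_stochastic_order3].
- by split=> //; exact: RDIWM_stochastic_order3.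
- by split=> //; exact: RDIWM_stochastic_order3.
- by split; apply: RDIWM_order32 => //; field.
(* Only alpha and [A0] enter, and these are rational. *)
- by split; split; rewrite /= !colseq3E; field.
Qed.
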